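(* Let $P$ be a finite ordered set, let $M$ be the chopped lattice of the 1960 construction for $P$, and let $\mathbf{u} \le \mathbf{v}$ be compatible vectors of $M$. For a sequence of cuts $\Sigma$ performed in a complete run of the Algorithm on $(\mathbf{u},\mathbf{v})$, let $\mathbf{s}_\Sigma$ denote the vector (a sectional complement of $\mathbf{u}$ in $\mathbf{v}$) produced by that run. Then $\mathbf{s}_\Sigma$ is independent of $\Sigma$; that is, if $\Sigma$ and $\Sigma'$ are any two sequences of cuts arising from complete runs of the Algorithm on $(\mathbf{u},\mathbf{v})$, then $\mathbf{s}_\Sigma = \mathbf{s}_{\Sigma'}$.
   Context: **The chopped lattice $M$.** $P$ is a finite ordered set (the join-irreducible elements of a finite distributive lattice); $x \succ y$ means $x$ covers $y$ in $P$. For $p \succ q$ in $P$, let $N(p,q) = \{0, p_1, q_1, q_2, q, p(q)\}$ be the six-element lattice with covering relations $0 \prec q_1 \prec q$, $0 \prec q_2 \prec q$, $q \prec p(q)$, $0 \prec p_1 \prec p(q)$ (and no others). $M$ is the union of all $N(p,q)$, $p \succ q$ in $P$, where elements with the same name are identified ($0$ is common to all; the elements $p_1$, $p_2$, $p$, when present, depend only on $p$; the element $p(q)$ depends on the pair $(p,q)$). Set $a \le b$ in $M$ iff $a,b$ lie in some $N(p,q)$ and $a \le b$ there. Then $M$ is a finite meet-semilattice with $0$ in which the maximal elements are the $p(q)$ and the principal ideal generated by $p(q)$ is $N(p,q)$. Meets $\wedge$ below are taken in $M$. **Vectors.** A vector is a family $\mathbf{c} = (c_{xy} \mid x \succ y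 \text{ in } P)$ with $c_{xy} \in N(x,y)$; vectors are ordered componentwise. $\mathbf{c}$ is compatible if $c_{xy} \wedge x'(y') = c_{x'y'} \wedge x(y)$ for all $x \succ y$, $x' \succ y'$ in $P$. Compatible vectors are identified with the ideals of $M$ and form the lattice $\mathrm{Id}\,M$. A sectional complement of $\mathbf u$ in $\mathbf v$ is an $\mathbf s$ in $\mathrm{Id}\,M$ with $\mathbf u\wedge \mathbf s=0$ and $\mathbf u\vee \mathbf s=\mathbf v$. **The vector $\mathbf{m}$.** For compatible $\mathbf{u} \le \mathbf{v}$, $\mathbf{m} = (m_{xy})$, where $m_{xy}$ is the largest element $s \in N(x,y)$ with $u_{xy} \wedge s = 0$ and $u_{xy} \vee s = v_{xy}$ (it exists). **$\mathcal V$-failures and $\mathcal V$-cuts.** A $\mathcal V$-suborder is $\{p,q,r\} \subseteq P$ with $p \ne q$, $p \succ r$, $q \succ r$. A vector $\mathbf{c}$ is $\mathcal V$-incompatible at $\{p,q,r\}$ if $c_{pr} \wedge r \ne c_{qr} \wedge r$; it has a $\mathcal V(p,q,r)$-failure if in addition $c_{pr} = m_{pr}$ and $c_{qr} = m_{qr}$. In case of a failure it is known that, up to interchanging $p,q$ and interchanging $r_1,r_2$, $m_{pr} = r_1$ and $m_{qr} = q_1$; the corresponding $\mathcal V$-cut of $\mathbf{c}$ replaces $c_{pr}$ by $0$ and leaves all other components unchanged. **$\mathcal C$-failures and $\mathcal C$-cuts.** A $\mathcal C$-suborder is $\{p,q,r\}\subseteq P$ with $p \succ q \succ r$. A vector $\mathbf{c}$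 is $\mathcal C$-incompatible at it if $c_{pq} \wedge q_1 \ne c_{qr} \wedge q_1$; it has a $\mathcal C(p,q,r)$-failure if in addition $c_{pq} = m_{pq}$ and $c_{qr} = m_{qr}$. In case of a failure it is known that $m_{pq} = p_1$ and $m_{qr} \in \{q_1, q(r)\}$; the corresponding $\mathcal C$-cut of $\mathbf{c}$ replaces $c_{qr}$ by $0$ if $m_{qr} = q_1$, and by $r$ if $m_{qr} = q(r)$, leaving all other components unchanged. A $\mathcal C(p,q,r)$-failure of $\mathbf{c}$ is minimal if there is no $\mathcal C(p',q',r')$-failure of $\mathbf{c}$ with $q' < q$. **Algorithm.** Given compatible $\mathbf{u} \le \mathbf{v}$. Step 1: set $\mathbf{c} = \mathbf{m}$. Step 2: choose an arbitrary $\mathcal V$-failure of $\mathbf{c}$ (if any) and replace $\mathbf{c}$ by the corresponding $\mathcal V$-cut; repeat until there are no more $\mathcal V$-failures. Step 3: choose a minimal $\mathcal C$-failure of $\mathbf{c}$ (if any) and replace $\mathbf{c}$ by the corresponding $\mathcal C$-cut; repeat until there are no more $\mathcal C$-failures. The final $\mathbf{c}$ is the output; for a run with sequence of cuts $\Sigma$ it is denoted $\mathbf{s}_\Sigma$. It is known from earlier work (Grätzer–Roddy) that $\mathbf{s}_\Sigma$ is compatible and is a sectional complement of $\mathbf u$ in $\mathbf v$ in $\mathrm{Id}\,M$. *)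

(* Defs.v *)
From HB Require Import structures.
From mathcomp Require Import all_boot all_order.

Set Implicit Arguments.
Unset Strict Implicit.
Unset Printing Implicit Defensive.

Import Order.TTheory.
Local Open Scope order_scope.

Definition covers d (P : finPOrderType d) (x y : P) : bool :=
  (y < x) && ~~ [exists z : P, (y < z) && (z < x)].

(* An edge [e] is a covering pair [hi e] > [lo e]; these pairs index the
   sublattices N(p, q) and the components of vectors.                         *)
Record edge d (P : finPOrderType d) := Edge {
  edge_pair : P * P;
  edgeP : covers edge_pair.1 edge_pair.2
}.

HB.instance Definition _ d (P : finPOrderType d) :=
  [isSub for @edge_pair d P].
HB.instance Definition _ d (P : finPOrderType d) :=
  [Finite of edge P by <:].

Definition hi d (P : finPOrderType d) (e : edge P) : P := (edge_pair e).1.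
Definition lo d (P : finPOrderType d) (e : edge P) : P := (edge_pair e).2.

(* The formal names 0, p_1, p_2, p, p(q) of elements of the chopped lattice M;
   not all of them occur in M, which is the subtype [chopped].                *)
Inductive name (P : Type) : Type :=
  | Zero | Fst of P | Snd of P | Mid of P | Top of P & P.

Arguments Zero {P}.

Definition name_code P (a : name P) : option (bool * P + (P + P * P)) :=
  match a with
  | Zero => None
  | Fst p => Some (inl (true, p))
  | Snd p => Some (inl (false, p))
  | Mid p => Some (inr (inl p))
  | Top p q => Some (inr (inr (p, q)))
  end.

Definition name_decode P (c : option (bool * P + (P + P * P))) : name P :=
  match c with
  | None => Zero
  | Some (inl (b, p)) => if b then Fst p else Snd p
  | Some (inr (inl p)) => Mid p
  | Some (inr (inr (p, q))) => Top p q
  end.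

Lemma name_codeK P : cancel (@name_code P) (@name_decode P).
Proof. by case. Qed.

HB.instance Definition _ (P : eqType) :=
  Equality.copy (name P) (can_type (@name_codeK P)).
HB.instance Definition _ (P : choiceType) :=
  Choice.copy (name P) (can_type (@name_codeK P)).
HB.instance Definition _ (P : countType) :=
  Countable.copy (name P) (can_type (@name_codeK P)).
HB.instance Definition _ (P : finType) :=
  isFinite.Build (name P) (pcan_enumP (can_pcan (@name_codeK P))).

(* The covering relations of N(p, q) are 0 < q_1 < q, 0 < q_2 < q, q < p(q)
   and 0 < p_1 < p(q).                                                         *)
Definition N_names (P : finType) (p q : P) : seq (name P) :=
  [:: Zero; Fst p; Fst q; Snd q; Mid q; Top p q].

Definition N_le (P : finType) (p q : P) (a b : name P) : bool :=
  [|| a == b, a == Zero, b == Top p q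
    | (b == Mid q) && ((a == Fst q) || (a == Snd q))].

(* The explicit [Zero] only matters when [P] has no covering pair, in which
   case M is taken to be {0} rather than empty.                             *)
Definition in_chopped d (P : finPOrderType d) (a : name P) : bool :=
  (a == Zero) || [exists e : edge P, a \in N_names (hi e) (lo e)].

Record chopped d (P : finPOrderType d) := Chopped {
  chopped_name : name P;
  choppedP : in_chopped chopped_name
}.

HB.instance Definition _ d (P : finPOrderType d) :=
  [isSub for @chopped_name d P].
HB.instance Definition _ d (P : finPOrderType d) :=
  [Finite of chopped P by <:].

(* Again, the disjunct [a == b] is needed only for 0 <= 0 when there is no
   covering pair.                                                             *)
Definition chopped_le d (P : finPOrderType d) (a b : chopped P) : bool :=
  (a == b) ||
  [exists e : edge P, [&& val a \in N_names (hi e) (lo e),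
                          val b \in N_names (hi e) (lo e)
                        & N_le (hi e) (lo e) (val a) (val b)]].

(* Principal ideals, listed from the top down, so that the first common
   member of two of them is the meet.                                         *)
Definition down (P : finType) (a : name P) : seq (name P) :=
  match a with
  | Zero => [:: Zero]
  | Fst p => [:: Fst p; Zero]
  | Snd p => [:: Snd p; Zero]
  | Mid q => [:: Mid q; Fst q; Snd q; Zero]
  | Top p q => [:: Top p q; Mid q; Fst q; Snd q; Fst p; Zero]
  end.

Definition name_meet (P : finType) (a b : name P) : name P :=
  head Zero [seq c <- down a | c \in down b].

Lemma edge_lt d (P : finPOrderType d) (e : edge P) : lo e < hi e.
Proof. by case/andP: (edgeP e). Qed.

Lemma name_eqE (P : finType) (a b : name P) :
  (a == b) = match a, b with
             | Zero, Zero => true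
             | Fst p, Fst q | Snd p, Snd q | Mid p, Mid q => p == q
             | Top p q, Top r s => (p == r) && (q == s)
             | _, _ => false
             end.
Proof. by case: a b => [|p|p|p|p q] [|r|r|r|r s]. Qed.

Ltac name_cases :=
  repeat (rewrite /= ?eqxx ?inE ?name_eqE /=;
    match goal with
    | H : (?x == ?y) = false |- context [?x == ?y] => rewrite H
    | H : (?x == ?y) = false |- context [?y == ?x] => rewrite [y == x]eq_sym H
    | |- context [?x == ?y] =>
        let E := fresh "E" in case: (eqVneq x y) => [E|/negbTE E]; try subst
    end); rewrite ?eqxx //=.

Lemma N_down d (P : finPOrderType d) (e : edge P) (a b : name P) :
  b \in N_names (hi e) (lo e) ->
  (a \in down b) = (a \in N_names (hi e) (lo e)) && N_le (hi e) (lo e) a b.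
Proof.
have := edge_lt e; move: (hi e) (lo e) => p q qp.
have pq : (p == q) = false by rewrite gt_eqF.
rewrite /N_names !inE => /or4P[|||/or3P[]] /eqP->; rewrite /N_le /= !inE;
  rewrite !name_eqE; case: a => [|r|r|r|r s] //=; name_cases.
Qed.

Lemma in_chopped_edge d (P : finPOrderType d) (e : edge P) (a : name P) :
  a \in N_names (hi e) (lo e) -> in_chopped a.
Proof. by move=> aN; apply/orP; right; apply/existsP; exists e. Qed.

Lemma down_refl (P : finType) (a : name P) : a \in down a.
Proof. by case: a => *; rewrite mem_head. Qed.

Lemma chopped_leE d (P : finPOrderType d) (a b : chopped P) :
  chopped_le a b = (val a \in down (val b)).
Proof.
apply/orP/idP => [[/eqP->|/existsP[e /and3P[aN bN ab]]]|ab].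
- exact: down_refl.
- by rewrite (N_down _ bN) aN.
case/orP: (choppedP b) => [/eqP b0|/existsP[e bN]].
  left; apply/eqP/val_inj; apply/eqP.
  by move: ab; rewrite /= b0 inE.
by right; apply/existsP; exists e; move: ab; rewrite (N_down _ bN) /= bN.
Qed.

Lemma chopped_down d (P : finPOrderType d) (a b : name P) :
  in_chopped b -> a \in down b -> in_chopped a.
Proof.
case/orP => [/eqP->|/existsP[e bN]].
  by rewrite inE => /eqP->; rewrite /in_chopped eqxx.
by rewrite (N_down _ bN) => /andP[aN _]; apply: in_chopped_edge aN.
Qed.

Lemma down_trans (P : finType) (a b c : name P) :
  a \in down b -> b \in down c -> a \in down c.
Proof.
case: a b c => [|p|p|p|p q] [|r|r|r|r s] [|t|t|t|t w];
  rewrite !inE !name_eqE //=; name_cases.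
Qed.

Lemma down_anti (P : finType) (a b : name P) :
  a \in down b -> b \in down a -> a = b.
Proof.
by case: a b => [|p|p|p|p q] [|r|r|r|r s]; rewrite !inE !name_eqE //=;
  name_cases.
Qed.

Lemma name_meetP d (P : finPOrderType d) (a b c : name P) :
  in_chopped a -> in_chopped b ->
  (c \in down (name_meet a b)) = (c \in down a) && (c \in down b).
Proof.
have top r s : in_chopped (Top r s : name P) -> s < r.
  rewrite /in_chopped /= => /existsP[e]; rewrite !inE !name_eqE /=.
  by case/andP => /eqP-> /eqP->; apply: edge_lt.
have asym r s : in_chopped (Top r s : name P) ->
    ~~ in_chopped (Top s r : name P).
  by move=> /top sr; apply/negP => /top /(lt_trans sr); rewrite ltxx.
case: a b => [|p|p|p|p q] [|r|r|r|r s] ha hb; rewrite /name_meet; name_cases.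
all: case: c => *; name_cases.
by case/negP: (asym _ _ ha).
Qed.

Section ChoppedOrder.
Context d (P : finPOrderType d).
Implicit Types a b c : chopped P.

Fact chopped_le_refl : reflexive (@chopped_le d P).
Proof. by move=> a; rewrite chopped_leE down_refl. Qed.

Fact chopped_le_anti : antisymmetric (@chopped_le d P).
Proof.
by move=> a b; rewrite !chopped_leE => /andP[ab ba]; apply/val_inj/down_anti.
Qed.

Fact chopped_le_trans : transitive (@chopped_le d P).
Proof. by move=> b a c; rewrite !chopped_leE; apply: down_trans. Qed.

HB.instance Definition _ := Order.Le_isPOrder.Build d (chopped P)
  chopped_le_refl chopped_le_anti chopped_le_trans.

Lemma leEchopped a b : (a <= b) = (chopped_name a \in down (chopped_name b)).
Proof. exact: chopped_leE. Qed.

Fact chopped_meet_subproof a b :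
  in_chopped (name_meet (chopped_name a) (chopped_name b)).
Proof.
apply: (chopped_down (choppedP a)).
have := down_refl (name_meet (chopped_name a) (chopped_name b)).
by rewrite (name_meetP _ (choppedP a) (choppedP b)) => /andP[].
Qed.

Definition chopped_meet a b := Chopped (chopped_meet_subproof a b).

Fact chopped_lexI c a b : (c <= chopped_meet a b) = (c <= a) && (c <= b).
Proof. by rewrite !leEchopped /= name_meetP ?choppedP. Qed.

HB.instance Definition _ := Order.POrder_isMeetSemilattice.Build d (chopped P)
  chopped_lexI.

Definition chopped0 : chopped P := @Chopped d P Zero isT.

Fact chopped_le0x a : chopped0 <= a.
Proof. by rewrite leEchopped /=; case: a => -[|p|p|p|p q] ?; rewrite !inE. Qed.

HB.instance Definition _ := Order.hasBottom.Build d (chopped P) chopped_le0x.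

End ChoppedOrder.

(* The element of M with the given name (the junk value 0 if there is none). *)
Definition named d (P : finPOrderType d) (a : name P) : chopped P :=
  insubd (chopped0 P) a.

Definition N d (P : finPOrderType d) (e : edge P) : {set chopped P} :=
  [set a | chopped_name a \in N_names (hi e) (lo e)].

Definition is_join_N d (P : finPOrderType d) (e : edge P)
    (a b c : chopped P) : bool :=
  [&& c \in N e, a <= c, b <= c
    & [forall x in N e, (a <= x) && (b <= x) ==> (c <= x)]].

Notation vec P := {ffun edge P -> chopped P}.

Definition is_vector d (P : finPOrderType d) (c : vec P) : Prop :=
  forall e, c e \in N e.

Definition vec_le d (P : finPOrderType d) (b c : vec P) : Prop :=
  forall e, b e <= c e.

Definition compatible d (P : finPOrderType d) (c : vec P) : Prop :=
  is_vector c /\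
  forall e f : edge P,
    c e `&` named (Top (hi f) (lo f)) = c f `&` named (Top (hi e) (lo e)).

Definition is_compl_N d (P : finPOrderType d) (e : edge P)
    (x y s : chopped P) : bool :=
  (x `&` s == \bot) && is_join_N e x s y.

Definition is_max_compl_N d (P : finPOrderType d) (e : edge P)
    (x y s : chopped P) : bool :=
  [&& s \in N e, is_compl_N e x y s
    & [forall t in N e, is_compl_N e x y t ==> (t <= s)]].

(* The default value of [odflt] is never used when [u <= v] are vectors, see
   [mvecP].                                                                   *)
Definition mvec d (P : finPOrderType d) (u v : vec P) : vec P :=
  [ffun e => odflt \bot [pick s | is_max_compl_N e (u e) (v e) s]].

Lemma in_named d (P : finPOrderType d) (e : edge P) (a : name P) :
  a \in N_names (hi e) (lo e) -> chopped_name (named a) = a.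
Proof. by move=> /in_chopped_edge aM; rewrite /named [LHS]insubdK. Qed.

Lemma forall_N d (P : finPOrderType d) (e : edge P) (Q : pred (name P)) :
  [forall x in N e, Q (chopped_name x)] = all Q (N_names (hi e) (lo e)).
Proof.
apply/forall_inP/allP => [H a aN | H x]; last by rewrite inE; apply: H.
by have := H (named a); rewrite inE (in_named aN) => /(_ aN).
Qed.

Definition name_map (S T : Type) (f : S -> T) (a : name S) : name T :=
  match a with
  | Zero => Zero
  | Fst p => Fst (f p)
  | Snd p => Snd (f p)
  | Mid p => Mid (f p)
  | Top p q => Top (f p) (f q)
  end.

Lemma max_compl_N_ex d (P : finPOrderType d) (e : edge P) (x y : chopped P) :
  x \in N e -> y \in N e -> x <= y -> exists s, is_max_compl_N e x y s.
Proof.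
pose jn (T : finType) p q (a b c : name T) := [&& c \in N_names p q,
  a \in down c, b \in down c &
  all (fun z => (a \in down z) && (b \in down z) ==> (c \in down z))
      (N_names p q)].
pose cp (T : finType) p q (a b s : name T) :=
  (name_meet a s == Zero) && jn T p q a s b.
pose mx (T : finType) p q (a b s : name T) :=
  cp T p q a b s && all (fun t => cp T p q a b t ==> (t \in down s)) (N_names p q).
have cpE a b s : is_compl_N e a b s
    = cp P (hi e) (lo e) (chopped_name a) (chopped_name b) (chopped_name s).
  rewrite /is_compl_N /cp -val_eqE /=; congr (_ && _).
  rewrite /is_join_N /jn inE !leEchopped -forall_N; do 3 congr (_ && _).
  by apply: eq_forallb_in => z _; rewrite !leEchopped.
rewrite !in_set leEchopped => xN yN xy.
suff [s sN /andP[sc smax]] : exists2 s, s \in N_names (hi e) (lo e) &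
    mx P (hi e) (lo e) (chopped_name x) (chopped_name y) s.
  exists (named s); rewrite /is_max_compl_N inE cpE (in_named sN) sN sc /=.
  apply/forall_inP => t; rewrite inE => tN; apply/implyP.
  by rewrite cpE leEchopped (in_named sN) => /(implyP (allP smax _ tN)).
pose f b := if b then hi e else lo e.
have finj : injective (name_map f).
  have hl : (hi e == lo e) = false by rewrite gt_eqF ?edge_lt.
  have fE b c : (f b == f c) = (b == c).
    by case: b c => -[]; rewrite /f ?eqxx ?[lo e == _]eq_sym ?hl.
  move=> a b /eqP; rewrite name_eqE => ab; apply/eqP; rewrite name_eqE.
  by case: a b ab => [|a|a|a|a a'] [|b|b|b|b b'] //=; rewrite !fE.
have downE a : down (name_map f a) = map (name_map f) (down a) by case: a.
have NE : N_names (hi e) (lo e) = map (name_map f) (N_names true false) by [].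
have meetE a b : name_meet (name_map f a) (name_map f b)
    = name_map f (name_meet a b).
  rewrite /name_meet !downE filter_map.
  by under eq_filter => c do rewrite /= (mem_map finj); case: [seq _ <- _ | _].
have jnE a b c : jn P (hi e) (lo e) (name_map f a) (name_map f b) (name_map f c)
    = jn bool true false a b c.
  rewrite /jn NE !downE !(mem_map finj) all_map; do 3 congr (_ && _).
  by apply: eq_all => z /=; rewrite !downE !(mem_map finj).
have cpf a b c : cp P (hi e) (lo e) (name_map f a) (name_map f b) (name_map f c)
    = cp bool true false a b c.
  by rewrite /cp meetE jnE -[Zero in LHS]/(name_map f Zero) (inj_eq finj).
have check : all (fun a => all (fun b => (a \in down b) ==>
    has (mx bool true false a b) (N_names true false))
    (N_names true false)) (N_names true false) by vm_compute.
move: xN yN xy; rewrite NE => /mapP[a aN ->] /mapP[b bN ->].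
rewrite downE (mem_map finj) => ab.
have /hasP[s sN sm] := implyP (allP (allP check a aN) b bN) ab.
exists (name_map f s); first by rewrite (mem_map finj).
rewrite /mx cpf NE; move: sm; rewrite /mx => /andP[-> smax]; rewrite andTb.
apply/allP => _ /mapP[t tN ->]; rewrite cpf downE (mem_map finj).
exact: allP smax t tN.
Qed.

Lemma mvecP d (P : finPOrderType d) (u v : vec P) :
  is_vector u -> is_vector v -> vec_le u v ->
  forall e, is_max_compl_N e (u e) (v e) (mvec u v e).
Proof.
move=> uN vN uv e; rewrite ffunE; case: pickP => [s //|no].
by have [s] := max_compl_N_ex (uN e) (vN e) (uv e); rewrite no.
Qed.

(* A V-suborder {p, q, r} is given by the edges e = (p, r) and f = (q, r), and
   a C-suborder p > q > r by the edges e = (p, q) and f = (q, r).             *)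

Definition V_suborder d (P : finPOrderType d) (e f : edge P) : bool :=
  (lo e == lo f) && (hi e != hi f).

Definition V_incompatible d (P : finPOrderType d) (c : vec P)
    (e f : edge P) : bool :=
  c e `&` named (Mid (lo e)) != c f `&` named (Mid (lo e)).

Definition V_failure d (P : finPOrderType d) (m c : vec P)
    (e f : edge P) : bool :=
  [&& V_suborder e f, V_incompatible c e f, c e == m e & c f == m f].

Definition C_suborder d (P : finPOrderType d) (e f : edge P) : bool :=
  lo e == hi f.

Definition C_incompatible d (P : finPOrderType d) (c : vec P)
    (e f : edge P) : bool :=
  c e `&` named (Fst (lo e)) != c f `&` named (Fst (lo e)).

Definition C_failure d (P : finPOrderType d) (m c : vec P)
    (e f : edge P) : bool :=
  [&& C_suborder e f, C_incompatible c e f, c e == m e & c f == m f].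

Definition minimal_C_failure d (P : finPOrderType d) (m c : vec P)
    (e f : edge P) : bool :=
  C_failure m c e f &&
  [forall e', forall f', C_failure m c e' f' ==> ~~ (lo e' < lo e)].

Inductive cut d (P : finPOrderType d) : Type :=
  | VCut of edge P & edge P
  | CCut of edge P & edge P.

Definition upd d (P : finPOrderType d) (c : vec P) (e : edge P)
    (a : chopped P) : vec P :=
  [ffun g => if g == e then a else c g].

Definition do_cut d (P : finPOrderType d) (m c : vec P) (k : cut P) : vec P :=
  match k with
  | VCut e f => upd c e \bot
  | CCut e f =>
      if m f == named (Fst (hi f)) then upd c f \bot
      else if m f == named (Top (hi f) (lo f)) then upd c f (named (Mid (lo f)))
      else c
  end.

(* It is known that m_e is r_1 or r_2 and m_f is q_1, up to interchanging e and
   f: [VCut e f] is the cut in that orientation, which resets component e. *)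
Definition V_step d (P : finPOrderType d) (m c : vec P) (k : cut P) : bool :=
  match k with
  | VCut e f =>
      [&& V_failure m c e f,
          (m e == named (Fst (lo e))) || (m e == named (Snd (lo e)))
        & m f == named (Fst (hi f))]
  | CCut _ _ => false
  end.

Definition C_step d (P : finPOrderType d) (m c : vec P) (k : cut P) : bool :=
  match k with
  | VCut _ _ => false
  | CCut e f => minimal_C_failure m c e f
  end.

Definition do_cuts d (P : finPOrderType d) (m c : vec P) (s : seq (cut P)) :
    vec P :=
  foldl (do_cut m) c s.

Fixpoint performable d (P : finPOrderType d)
    (step : vec P -> vec P -> cut P -> bool) (m c : vec P) (s : seq (cut P)) :
    bool :=
  if s is k :: s' then step m c k && performable step m (do_cut m c k) s'
  else true.

Definition complete_run d (P : finPOrderType d) (u v : vec P)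
    (s : seq (cut P)) : Prop :=
  let m := mvec u v in
  exists sV sC : seq (cut P),
    [/\ s = sV ++ sC,
        performable (@V_step d P) m m sV,
        forall e f, ~~ V_failure m (do_cuts m m sV) e f,
        performable (@C_step d P) m (do_cuts m m sV) sC
      & forall e f, ~~ C_failure m (do_cuts m m s) e f].

Definition output d (P : finPOrderType d) (u v : vec P) (s : seq (cut P)) :
    vec P :=
  let m := mvec u v in do_cuts m m s.

(* Main.v *)
(* Only components with m_pq = p_1 trigger V-cuts, and these are never V-cut
   themselves, so Step 2 resets exactly the components that are the target of a
   V-failure of m.  Let c0 be the result.  By minimality, a component e can only
   be C-cut once all the C-failures of c0 that e triggers have been repaired,
   so Step 3 cuts exactly the components that are the target of a C-failure of
   c0.  Both outcomes are described without reference to the sequence of cuts. *)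
Require Import Defs.
From mathcomp Require Import all_boot all_order.

Set Implicit Arguments.
Unset Strict Implicit.
Unset Printing Implicit Defensive.

Import Order.TTheory.
Local Open Scope order_scope.

Section Cuts.
Context d (P : finPOrderType d).
Implicit Types (m c : vec P) (e f : edge P) (k : cut P) (s : seq (cut P)).

Lemma performable_ind (step : vec P -> vec P -> cut P -> bool) m
    (I : vec P -> Prop) c s :
  (forall b k, I b -> step m b k -> I (do_cut m b k)) ->
  I c -> performable step m c s -> I (do_cuts m c s).
Proof.
move=> Istep; elim: s c => [//|k s IHs] c Ic /= /andP[ck].
by apply: IHs; apply: Istep.
Qed.

Lemma named_Fst_hi e : (named (Fst (hi e)) == named (Fst (lo e))) = false.
Proof.
rewrite -(inj_eq val_inj) /= !(@in_named _ _ e) ?inE ?eqxx ?orbT //.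
by rewrite name_eqE gt_eqF ?edge_lt.
Qed.

Lemma named_Fst_Snd e : (named (Fst (hi e)) == named (Snd (lo e))) = false.
Proof.
by rewrite -(inj_eq val_inj) /= !(@in_named _ _ e) ?inE ?eqxx ?orbT.
Qed.

Definition V_cut_all m : vec P :=
  [ffun e => if [exists f, V_step m m (VCut e f)] then \bot else m e].

Lemma do_V_cuts m s :
  performable (@V_step d P) m m s ->
  (forall e f, ~~ V_failure m (do_cuts m m s) e f) ->
  do_cuts m m s = V_cut_all m.
Proof.
(* The second alternative excludes triggers: a trigger [f] of a V-cut has [m f] equal to
   [named (Fst (hi f))], so it always keeps this value. *)
pose I c := forall e, c e = m e \/ c e = V_cut_all m e /\
  m e != named (Fst (hi e)).
move=> sP; have: I (do_cuts m m s).
  apply: performable_ind sP => [b [e f|//] Ib|]; last by left.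
  case/and3P=> /and4P[ef bI /eqP be /eqP bf] me mf g.
  rewrite ffunE; case: eqP => [->|_]; last exact: Ib.
  right; split; last first.
    by case/orP: me => /eqP->; rewrite eq_sym ?named_Fst_hi ?named_Fst_Snd.
  rewrite ffunE ifT //; apply/existsP; exists f.
  move: bI; rewrite /= me mf /V_failure ef /V_incompatible be bf => ->.
  by rewrite !eqxx.
move: (do_cuts m m s) => c Ic cV; apply/ffunP => e.
case: (Ic e) => [ce|[] //]; rewrite ffunE.
case: existsP => [[f /and3P[/and4P[ef mI _ _] me mf]]|_ //].
(* The trigger [f] is intact; if [e] were too, the V-failure of [m] would survive in [c]. *)
have cf : c f = m f by case: (Ic f) => // -[_ /negP].
have /negP[] := cV e f.
by move: mI; rewrite /V_failure ef /V_incompatible ce cf => ->; rewrite !eqxx.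
Qed.

(* [do_cut] ignores the first edge of a C-cut, so any edge would do there. *)
Definition C_cut_value m f : chopped P := do_cut m m (CCut f f) f.

Lemma do_C_cut m c e f :
  c f = m f -> do_cut m c (CCut e f) = upd c f (C_cut_value m f).
Proof.
move=> cf; rewrite /C_cut_value /=.
case: ifP => _; [|case: ifP => _].
- by rewrite [in RHS]ffunE eqxx.
- by rewrite [in RHS]ffunE eqxx.
(* Here the cut is the identity and [C_cut_value m f] is [m f], which equals [c f]. *)
by apply/ffunP => g; rewrite ffunE; case: eqP => // ->.
Qed.

Definition C_cut_all m c : vec P :=
  [ffun f => if [exists e, C_failure m c e f] then C_cut_value m f else c f].

Lemma do_C_cuts m c0 s :
  performable (@C_step d P) m c0 s ->
  (forall e f, ~~ C_failure m (do_cuts m c0 s) e f) ->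
  do_cuts m c0 s = C_cut_all m c0.
Proof.
(* The last clause records the order of cuts: a trigger changes only after all its targets in [c0]
   have changed. *)
pose I c :=
  [/\ forall f, c f != c0 f -> c f = C_cut_all m c0 f,
      forall f, c f = m f -> c0 f = m f
    & forall e f, C_failure m c0 e f -> c e != c0 e -> c f != c0 f].
move=> sP; have: I (do_cuts m c0 s).
  apply: performable_ind sP => [b [//|e f] [Ib Im Id]|]; last first.
    by split=> // [f|e f _]; rewrite eqxx.
  case/andP=> /and4P[ef bI /eqP be /eqP bf] bmin; rewrite do_C_cut //.
  have c0e := Im _ be; have c0f := Im _ bf.
  have fail0 : C_failure m c0 e f.
    move: bI; rewrite /C_failure ef /C_incompatible be bf c0e c0f => ->.
    by rewrite !eqxx.
  have cutf : C_cut_all m c0 f = C_cut_value m f.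
    by rewrite ffunE ifT //; apply/existsP; exists e.
  split=> [g|g|g h gh]; rewrite ![upd _ _ _ _]ffunE.
  - by case: (eqVneq g f) => [->|_ /Ib].
  - by case: (eqVneq g f) => [->|_ /Im].
  case: (eqVneq g f) gh => [->|_] gh neq; last first.
    have := Id _ _ gh neq; case: (eqVneq h f) => [->|//].
    by rewrite bf c0f eqxx.
  case/and4P: gh => fh c0I _ /eqP c0h.
  have hf : (h == f) = false.
    apply/negP => /eqP hf; move: (edge_lt f) fh.
    by rewrite hf /C_suborder => /lt_eqF->.
  rewrite hf; apply/negP => /eqP bh.
  (* If [h] were unchanged, [f] and [h] would give a C-failure of [b] at [lo f], strictly below
     [hi f = lo e], against minimality. *)
  have failb : C_failure m b f h.
    move: c0I; rewrite /C_failure fh /C_incompatible bh bf c0f c0h => ->.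
    by rewrite !eqxx.
  move/forallP/(_ f)/forallP/(_ h)/implyP/(_ failb): bmin.
  by rewrite (eqP ef) edge_lt.
move: (do_cuts m c0 s) => c [Ic Im Id] cC; apply/ffunP => f.
case: (eqVneq (c f) (c0 f)) => [cf|/Ic //]; rewrite ffunE.
case: existsP => [[e fail]|_ //].
(* An unchanged target forces an unchanged trigger, so the C-failure of [c0] would persist in the
   final vector. *)
have ce : c e = c0 e.
  by apply/eqP; apply: contraT => /(Id _ _ fail); rewrite cf eqxx.
by have /negP[] := cC e f; rewrite /C_failure /C_incompatible ce cf.
Qed.

Lemma output_complete_run (u v : vec P) s :
  complete_run u v s ->
  output u v s = C_cut_all (mvec u v) (V_cut_all (mvec u v)).
Proof.
case=> sV [sC [-> sVP sVN sCP sCN]]; rewrite /output.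
have cat_cuts m : do_cuts m m (sV ++ sC) = do_cuts m (do_cuts m m sV) sC.
  exact: foldl_cat.
move: sCN; rewrite cat_cuts => sCN.
by rewrite do_C_cuts // do_V_cuts.
Qed.

End Cuts.

Theorem theorem2 (d : Order.disp_t) (P : finPOrderType d) (u v : vec P)
    (hu : compatible u) (hv : compatible v) (huv : vec_le u v)
    (Sigma Sigma' : seq (cut P))
    (hSigma : complete_run u v Sigma) (hSigma' : complete_run u v Sigma') :
  output u v Sigma = output u v Sigma'.
Proof. by rewrite !output_complete_run. Qed.
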